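(* The $(\mathrm{median},-)$ convolution of two vectors of length $n$ can be computed in $O(n\sqrt{n\lg n})$ time in the nonuniform linear decision tree model.
   Context: For vectors $\vec x=\langle x_0,\dots,x_{n-1}\rangle$, $\vec y=\langle y_0,\dots,y_{n-1}\rangle$ of reals, the $(\mathrm{median},-)$ convolution has $k$th entry $\mathrm{median}_{i=0}^{k}(x_i-y_{k-i})$, $k=0,\dots,n-1$. In the nonuniform linear decision tree model, for each input size there is a separate decision tree whose internal nodes test the sign of a linear function of the input values; the cost is the depth of the tree. *)

(* Defs.v *)
From Stdlib Require Import Reals List Arith.
Import ListNotations.
Open Scope R_scope.

Fixpoint insert_R (x : R) (l : list R) : list R :=
  match l with
  | [] => [x]
  | y :: l' => if Rle_dec x y then x :: y :: l' else y :: insert_R x l'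
  end.

Fixpoint sort_R (l : list R) : list R :=
  match l with
  | [] => []
  | x :: l' => insert_R x (sort_R l')
  end.

(* Lower median: the element of rank floor((m-1)/2) (0-indexed) in sorted order
   of a list of length m. *)
Definition median (l : list R) : R :=
  nth (Nat.div (pred (length l)) 2) (sort_R l) 0.

(* ---------- (median,-) convolution ----------
   The input vectors x, y of length n are encoded in one input z : nat -> R
   with x_i = z i and y_j = z (n + j), i, j < n.  Entry k (k < n) is
   median_{i=0..k} (x_i - y_{k-i}). *)
Definition median_conv (n : nat) (z : nat -> R) (k : nat) : R :=
  median (map (fun i => z i - z (n + (k - i))%nat) (seq 0 (S k))).

Definition lin_form (m : nat) (a : nat -> R) (b : R) (z : nat -> R) : R :=
  fold_right Rplus 0 (map (fun i => a i * z i) (seq 0 m)) + b.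

(* Internal nodes test the sign of an affine function of the input
   (three-way branch: < 0, = 0, > 0).  A leaf specifies, for every output
   coordinate k, an affine function (coefficients, constant) of the input. *)
Inductive ldt : Type :=
| Leaf (out : nat -> (nat -> R) * R)
| Node (a : nat -> R) (b : R) (tlt teq tgt : ldt).

Fixpoint ldt_leaf (m : nat) (t : ldt) (z : nat -> R) : nat -> (nat -> R) * R :=
  match t with
  | Leaf out => out
  | Node a b tlt teq tgt =>
      match total_order_T (lin_form m a b z) 0 with
      | inleft (left _) => ldt_leaf m tlt z
      | inleft (right _) => ldt_leaf m teq z
      | inright _ => ldt_leaf m tgt z
      end
  end.

Definition ldt_output (m : nat) (t : ldt) (z : nat -> R) (k : nat) : R :=
  lin_form m (fst (ldt_leaf m t z k)) (snd (ldt_leaf m t z k)) z.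

Fixpoint depth (t : ldt) : nat :=
  match t with
  | Leaf _ => 0
  | Node _ _ t1 t2 t3 => S (Nat.max (depth t1) (Nat.max (depth t2) (depth t3)))
  end.

(* t computes the (median,-) convolution of two length-n vectors:
   inputs range over R^(2n) (only z 0 .. z (2n-1) are read). *)
Definition computes_median_conv (n : nat) (t : ldt) : Prop :=
  forall z : nat -> R, forall k : nat, (k < n)%nat ->
    ldt_output (2 * n) t z k = median_conv n z k.

Definition lg (x : R) : R := ln x / ln 2.

(* Main.v *)
(** The tree learns the sign of every form [(x_i - y_{k-i}) - (x_j - y_{k-j})],
    hence the sorted order of every diagonal, and the median is then a fixed
    difference of inputs.  There are about [n^3] such forms in dimension [2n],
    but they have small inference dimension (Kane, Lovett, Moran): if nonnegative
    values [g_1 <= ... <= g_d] of forms with small integer coefficients are such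
    that no prefix forces the next form to be nonnegative, then all subset sums of
    the increments [g_i - g_{i-1}] are distinct forms, so [d = O(n lg n)].
    Thus the answer on any sorted sample is forced by a subsequence of length [d].
    There are few such subsequences, so a sample of [O(n lg^2 n)] forms meets
    the uninferred set of each one that leaves more than half of the forms open.
    Sorting this sample by absolute value therefore settles half of the forms;
    [O(lg n)] rounds settle all, within [O(n lg^4 n)] tests. *)

Require Import Defs.
From Stdlib Require Import Reals List Arith.
From Stdlib Require Import ZArith Lra Lia Sorted ClassicalEpsilon.
Import ListNotations.
Open Scope R_scope.

(** The model charges only for tests of the input, so a procedure may consult classical truths about
    the forms, such as [infers], for free. *)
Definition holds (P : Prop) : bool :=
  if excluded_middle_informative P then true else false.

Lemma holds_true (P : Prop) : holds P = true <-> P.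
Proof. unfold holds; destruct excluded_middle_informative; intuition discriminate. Qed.

Lemma holds_false (P : Prop) : holds P = false <-> ~ P.
Proof. unfold holds; destruct excluded_middle_informative; intuition discriminate. Qed.

(** * Counting lists *)

Fixpoint tuples {A} (l : list A) (k : nat) : list (list A) :=
  match k with
  | O => [[]]
  | S k' => flat_map (fun t => map (fun a => a :: t) l) (tuples l k')
  end.

Lemma length_tuples {A} (l : list A) k : length (tuples l k) = (length l ^ k)%nat.
Proof.
  induction k as [|k IH]; [reflexivity|]; cbn [tuples].
  rewrite (@flat_map_constant_length _ _ (length l)).
  - rewrite IH; cbn; lia.
  - intros; apply length_map.
Qed.

Lemma in_tuples {A} (l : list A) k t :
  In t (tuples l k) <-> length t = k /\ incl t l.
Proof.
  revert t; induction k as [|k IH]; intros t; cbn [tuples].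
  - split; [intros [<-|[]]; split; [reflexivity|apply incl_nil_l]|].
    intros [H _]; left; symmetry; now apply length_zero_iff_nil.
  - rewrite in_flat_map; split.
    + intros (u & Hu & Ht); apply in_map_iff in Ht as (a & <- & Ha).
      apply IH in Hu as [Hl Hi]; cbn; split; [lia|]; now apply incl_cons.
    + intros [Hl Hi]; destruct t as [|a t]; [discriminate|].
      apply incl_cons_inv in Hi as [Ha Hi]; exists t; split.
      * apply IH; split; [cbn in Hl; lia|assumption].
      * now apply (in_map (fun a => a :: t)).
Qed.

Lemma NoDup_tuples {A} (l : list A) k : NoDup l -> NoDup (tuples l k).
Proof.
  intros Hl; induction k as [|k IH]; cbn [tuples].
  - constructor; [intros []|constructor].
  - induction IH as [|t L Ht HL IHL]; cbn; [constructor|].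
    apply NoDup_app; [|exact IHL|].
    + apply NoDup_map_NoDup_ForallPairs; [|assumption].
      intros a b _ _ E; congruence.
    + intros u Hu Hu'; apply in_map_iff in Hu as (a & <- & Ha).
      apply in_flat_map in Hu' as (t' & Ht' & Hu').
      apply in_map_iff in Hu' as (b & E & _); congruence.
Qed.

Lemma length_filter_le_filter {A} (f g : A -> bool) l :
  (forall a, f a = true -> g a = true) ->
  (length (filter f l) <= length (filter g l))%nat.
Proof.
  intros H; induction l as [|a l IH]; cbn; [lia|].
  specialize (H a); destruct (f a), (g a); cbn; try lia.
Qed.

Lemma list_sum_le {A} (f g : A -> nat) l :
  (forall a, In a l -> (f a <= g a)%nat) ->
  (list_sum (map f l) <= list_sum (map g l))%nat.
Proof.
  induction l as [|a l IH]; intros H; cbn; [lia|].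
  assert (f a <= g a)%nat by (apply H; now left).
  assert (list_sum (map f l) <= list_sum (map g l))%nat
    by (apply IH; intros; apply H; now right).
  unfold list_sum in *; lia.
Qed.

Lemma list_sum_const {A} c (l : list A) :
  list_sum (map (fun _ => c) l) = (length l * c)%nat.
Proof. induction l as [|a l IH]; cbn in *; unfold list_sum in *; lia. Qed.

Lemma list_sum_add {A} (f g : A -> nat) l :
  list_sum (map (fun a => f a + g a)%nat l)
  = (list_sum (map f l) + list_sum (map g l))%nat.
Proof. induction l as [|a l IH]; cbn in *; unfold list_sum in *; lia. Qed.

Lemma double_counting {A} (F : list (A -> bool)) (U : list A) :
  list_sum (map (fun P => length (filter P U)) F)
  = list_sum (map (fun a => length (filter (fun P => P a) F)) U).
Proof.
  induction F as [|P F IH].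
  - cbn; rewrite list_sum_const; lia.
  - cbn [map filter]; cbn [list_sum fold_right].
    change (fold_right Nat.add 0%nat) with list_sum; rewrite IH.
    rewrite (map_ext (fun a => length (if P a then P :: filter (fun P => P a) F
                                       else filter (fun P => P a) F))
               (fun a => (if P a then 1 else 0) + length (filter (fun P => P a) F))%nat)
      by (intros a; destruct (P a); reflexivity).
    rewrite list_sum_add; f_equal.
    clear; induction U as [|a U IH]; [reflexivity|]; cbn.
    destruct (P a); cbn; unfold list_sum in *; lia.
Qed.

(** Averaging: were every element in at most half of the sets, the incidences counted by elements
    would be at most half of [length U * length F]; counted by sets they exceed it. *)
Lemma exists_popular {A} (F : list (A -> bool)) (U : list A) :
  F <> [] ->
  (forall P, In P F -> (length U < 2 * length (filter P U))%nat) ->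
  exists a, In a U /\ (length F < 2 * length (filter (fun P => P a) F))%nat.
Proof.
  intros HF Hbig; apply NNPP; intros Hno.
  assert (H1 : (length F * S (length U)
                <= list_sum (map (fun P => 2 * length (filter P U)) F))%nat).
  { rewrite <- list_sum_const; apply list_sum_le; intros P HP.
    specialize (Hbig P HP); lia. }
  assert (H2 : (list_sum (map (fun a => 2 * length (filter (fun P => P a) F)) U)
                <= length U * length F)%nat).
  { rewrite <- list_sum_const; apply list_sum_le; intros a Ha.
    apply Nat.nlt_ge; intros Hlt; apply Hno; now exists a. }
  assert (E : forall (B : Type) (f : B -> nat) l,
             list_sum (map (fun b => 2 * f b)%nat l) = (2 * list_sum (map f l))%nat).
  { intros B f l; induction l as [|b l IH]; cbn in *; unfold list_sum in *; lia. }
  rewrite E in H1, H2; rewrite double_counting in H1.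
  destruct F; [congruence|]; cbn [length] in *; nia.
Qed.

(* Greedy choice: each chosen element lies in more than half of the large sets
   not yet hit. *)
Lemma hitting_set {A} k (F : list (A -> bool)) (U : list A) :
  (length F < 2 ^ k)%nat ->
  exists S, incl S U /\ (length S <= k)%nat /\
    forall P, In P F -> (length U < 2 * length (filter P U))%nat ->
      exists a, In a S /\ P a = true.
Proof.
  revert F; induction k as [|k IH]; intros F HF.
  - exists []; split; [apply incl_nil_l|]; split; [cbn; lia|].
    intros P HP; destruct F; [destruct HP|cbn in HF; lia].
  - pose (big := fun P : A -> bool => Nat.ltb (length U) (2 * length (filter P U))).
    assert (Hlen : (length (filter big F) <= length F)%nat) by apply filter_length_le.
    destruct (filter big F) as [|P0 G] eqn:EG.
    + exists []; split; [apply incl_nil_l|]; split; [cbn; lia|].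
      intros P HP Hbig.
      assert (HIn : In P (filter big F))
        by (apply filter_In; split; [assumption|now apply Nat.ltb_lt]).
      rewrite EG in HIn; destruct HIn.
    + rewrite <- EG in Hlen; destruct (exists_popular (filter big F) U) as (a & Ha & Hpop).
      * rewrite EG; discriminate.
      * intros P HP; apply filter_In in HP as [_ HP]; now apply Nat.ltb_lt.
      * pose proof (filter_length (fun P : A -> bool => P a) (filter big F)) as Hsplit.
        destruct (IH (filter (fun P => negb (P a)) (filter big F))) as (S & HS & HSk & Hhit).
        { cbn in HF; lia. }
        exists (a :: S); split; [now apply incl_cons|]; split; [cbn; lia|].
        intros P HP Hbig; destruct (P a) eqn:EP; [exists a; split; [now left|assumption]|].
        destruct (Hhit P) as (b & Hb & HPb); [|assumption|exists b; split; [now right|assumption]].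
        apply filter_In; split; [|now rewrite EP].
        apply filter_In; split; [assumption|now apply Nat.ltb_lt].
Qed.

(** * Decision procedures *)

Section Decides.

Variables (X : Type) (query : (X -> R) -> Prop).

(* [D] is what the tests made so far reveal about the input, [c] bounds the number
   of tests still to come, [Q] specifies the value returned. *)
Inductive decides {T} (Q : X -> T -> Prop) : nat -> (X -> Prop) -> Prop :=
| decides_known c (D : X -> Prop) v : (forall z, D z -> Q z v) -> decides Q c D
| decides_test c (D : X -> Prop) q : query q ->
    decides Q c (fun z => D z /\ 0 <= q z) ->
    decides Q c (fun z => D z /\ q z <= 0) ->
    decides Q (S c) D.

Lemma decides_weaken {T} (Q Q' : X -> T -> Prop) c c' (D D' : X -> Prop) :
  decides Q c D -> (c <= c')%nat -> (forall z, D' z -> D z) ->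
  (forall z v, D' z -> Q z v -> Q' z v) -> decides Q' c' D'.
Proof.
  intros H; revert c' D'; induction H as [c D v Hv|c D q Hq H1 IH1 H2 IH2];
    intros c' D' Hc HD HQ.
  - apply decides_known with v; auto.
  - destruct c' as [|c']; [lia|]; apply decides_test with q; [assumption| |].
    + apply IH1; [lia|firstorder|firstorder].
    + apply IH2; [lia|firstorder|firstorder].
Qed.

Lemma decides_bind {T T'} (P : X -> T -> Prop) (Q : X -> T' -> Prop) c1 c2 D :
  decides P c1 D -> (forall v, decides Q c2 (fun z => D z /\ P z v)) ->
  decides Q (c1 + c2) D.
Proof.
  induction 1 as [c D v Hv|c D q Hq H1 IH1 H2 IH2]; intros HQ.
  - apply (decides_weaken _ _ _ _ _ _ (HQ v)); [lia|auto|auto].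
  - apply decides_test with q; [assumption|apply IH1|apply IH2];
      intros v; apply (decides_weaken _ _ _ _ _ _ (HQ v)); firstorder.
Qed.

(** * Inference *)

Variables (A : Type) (ev : X -> A -> R) (neg : A -> A).
Hypothesis ev_neg : forall z a, ev z (neg a) = - ev z a.
Hypothesis query_ev : forall a, query (fun z => ev z a).
Hypothesis query_sub : forall a b, query (fun z => ev z a - ev z b).

Fixpoint descending (z : X) (l : list A) : Prop :=
  match l with
  | [] => True
  | a :: l' => 0 <= ev z a /\ (forall b, In b l' -> ev z b <= ev z a) /\ descending z l'
  end.

Definition infers (l : list A) (a : A) : Prop :=
  forall z, descending z l -> 0 <= ev z a.

(** Lists run from the largest value down, so the tail [l'] holds the smaller values, and a chain is
    built from its end. *)
Fixpoint independent (l : list A) : Prop :=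
  match l with
  | [] => True
  | a :: l' => ~ infers l' a /\ independent l'
  end.

Definition unresolved (l : list A) (a : A) : bool :=
  negb (holds (infers l a \/ infers l (neg a))).

Lemma descending_app z l1 l2 :
  descending z (l1 ++ l2) <->
  descending z l1 /\ descending z l2 /\
  (forall a b, In a l1 -> In b l2 -> ev z b <= ev z a).
Proof.
  induction l1 as [|c l1 IH]; cbn; [intuition|].
  rewrite IH; setoid_rewrite in_app_iff; split.
  - intros (H1 & H2 & H3 & H4 & H5); repeat split; auto.
    intros a b [<-|Ha] Hb; auto.
  - intros ((H1 & H2 & H3) & H4 & H5); repeat split; auto.
    intros b [Hb|Hb]; auto.
Qed.

(** Greedy choice from the bottom of [T]: an element is kept only if those already kept below it do
    not force it. The result is a sublist, hence descending whenever [T] is, and elements added on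
    top preserve earlier inferences. *)
Lemma exists_basis T :
  exists B, incl B T /\ independent B /\
    (forall z, descending z T -> descending z B) /\
    (forall a, In a T -> infers B a).
Proof.
  induction T as [|a T (B & HBT & HB & Hdesc & Hinf)].
  - exists []; cbn; firstorder; apply incl_nil_l.
  - destruct (classic (infers B a)) as [Ha|Ha].
    + exists B; split; [now apply incl_tl|]; split; [assumption|]; split.
      * intros z Hz; apply Hdesc, Hz.
      * intros b [<-|Hb]; auto.
    + exists (a :: B); split; [apply incl_cons; [now left|now apply incl_tl]|].
      split; [now split|]; split.
      * intros z (H1 & H2 & H3); cbn; auto.
      * intros b [<-|Hb] z Hz; [apply Hz|apply (Hinf b Hb), Hz].
Qed.

(* Subset sums of the increments of a descending list, [0] being below its last
   element. *)
Fixpoint increment_sum (z : X) (e : list bool) (l : list A) : R :=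
  match e, l with
  | b :: e', a :: l' =>
      (if b then ev z a - hd 0 (map (ev z) l') else 0) + increment_sum z e' l'
  | _, _ => 0
  end.

(** All increments are nonnegative and together they telescope to the head. *)
Lemma increment_sum_bounds z e l :
  descending z l -> 0 <= increment_sum z e l <= hd 0 (map (ev z) l).
Proof.
  revert e; induction l as [|a l IH]; intros e Hl.
  - destruct e as [|b e]; cbn; lra.
  - destruct Hl as (H1 & H2 & H3).
    assert (hd 0 (map (ev z) l) <= ev z a).
    { destruct l as [|c l]; cbn; [assumption|apply H2; now left]. }
    destruct e as [|b e]; cbn; [lra|]; specialize (IH e H3); destruct b; lra.
Qed.

(** At the topmost difference, with [a] above [l], equality says that [a] equals the head of [l]
    plus a difference of two subset sums over [l]. By the bounds that difference is at least minus
    the head, so [l] would infer [a]. *)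
Lemma increment_sum_inj l e e' :
  independent l -> length e = length l -> length e' = length l ->
  (forall z, increment_sum z e l = increment_sum z e' l) -> e = e'.
Proof.
  assert (top : forall a l e e',
    (forall z, increment_sum z (true :: e) (a :: l)
               = increment_sum z (false :: e') (a :: l)) -> infers l a).
  { intros a l0 e0 e0' H z Hz; specialize (H z); cbn in H.
    pose proof (increment_sum_bounds z e0 l0 Hz).
    pose proof (increment_sum_bounds z e0' l0 Hz); lra. }
  revert e e'; induction l as [|a l IH]; intros e e' Hl He He' Heq.
  - destruct e, e'; try discriminate; reflexivity.
  - destruct e as [|b e], e' as [|b' e']; try discriminate.
    destruct Hl as [Ha Hl].
    assert (E : b = b').
    { destruct b, b'; try reflexivity; exfalso; apply Ha.
      - exact (top _ _ _ _ Heq).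
      - apply (top a l e' e); intros z; symmetry; apply Heq. }
    subst b'; f_equal; apply IH; [assumption|cbn in He; lia|cbn in He'; lia|].
    intros z; specialize (Heq z); cbn in Heq; lra.
Qed.

(** * Sorting a sample *)

Lemma split_middle (T : list A) k :
  T <> [] -> (length T < 2 ^ S k)%nat ->
  exists T1 m T2, T = T1 ++ m :: T2 /\ (length T1 < 2 ^ k)%nat /\ (length T2 < 2 ^ k)%nat.
Proof.
  intros HT Hlen; destruct T as [|a T]; [congruence|].
  set (L := a :: T) in *.
  assert (Hpos : (0 < length L)%nat) by (cbn; lia).
  pose proof (Nat.div_mod_eq (length L) 2); pose proof (Nat.mod_upper_bound (length L) 2).
  destruct (nth_split L a (n := length L / 2)) as (T1 & T2 & E & E1); [lia|].
  exists T1, (nth (length L / 2) L a), T2; split; [exact E|].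
  assert (length L = length T1 + S (length T2))%nat by (rewrite E, length_app; reflexivity).
  rewrite Nat.pow_succ_r' in Hlen; clearbody L; lia.
Qed.

(** Binary search: one test against a middle element leaves a part of length below half of
    [2 ^ k]. *)
Lemma decides_position g k T (D : X -> Prop) :
  (length T < 2 ^ k)%nat -> (forall z, D z -> descending z T) ->
  decides (fun z p => T = fst p ++ snd p /\
      (forall b, In b (fst p) -> ev z g <= ev z b) /\
      (forall b, In b (snd p) -> ev z b <= ev z g)) k D.
Proof.
  revert T D; induction k as [|k IH]; intros T D HT HD.
  - destruct T; [|cbn in HT; lia].
    apply decides_known with ([], []); firstorder.
  - destruct (classic (T = [])) as [->|Hne].
    { apply decides_known with ([], []); firstorder. }
    destruct (split_middle T k Hne HT) as (T1 & m & T2 & -> & H1 & H2).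
    assert (HD' : forall z, D z -> descending z T1 /\ descending z T2 /\
        (forall b, In b T2 -> ev z b <= ev z m) /\ (forall b, In b T1 -> ev z m <= ev z b)).
    { intros z Hz; apply HD, descending_app in Hz as (Ha & (_ & Hb & Hc) & Hd).
      repeat split; auto; intros b Hb'; apply Hd; [assumption|now left]. }
    apply decides_test with (fun z => ev z m - ev z g); [apply query_sub| |].
    + rewrite <- (Nat.add_0_r k); eapply decides_bind;
        [apply (IH T2); [assumption|intros z [Hz _]; apply HD', Hz]|].
      intros [P1 P2]; apply decides_known with (T1 ++ m :: P1, P2); cbn.
      intros z ((Hz & Hm) & -> & HP1 & HP2).
      destruct (HD' z Hz) as (_ & _ & Hb & Hc).
      split; [now rewrite <- app_assoc|]; split; [|assumption].
      intros b Hb'; apply in_app_iff in Hb' as [Hb'|[<-|Hb']]; [|lra|auto].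
      specialize (Hc b Hb'); lra.
    + rewrite <- (Nat.add_0_r k); eapply decides_bind;
        [apply (IH T1); [assumption|intros z [Hz _]; apply HD', Hz]|].
      intros [P1 P2]; apply decides_known with (P1, P2 ++ m :: T2); cbn.
      intros z ((Hz & Hm) & -> & HP1 & HP2).
      destruct (HD' z Hz) as (_ & _ & Hb & Hc).
      split; [now rewrite <- app_assoc|]; split; [assumption|].
      intros b Hb'; apply in_app_iff in Hb' as [Hb'|[<-|Hb']]; [auto|lra|].
      specialize (Hb b Hb'); lra.
Qed.

(** Sorting by absolute value, each form being represented by whichever of itself and its negation
    is nonnegative. The length is recorded to bound the next binary search. *)
Definition signed_sort (S : list A) (z : X) (T : list A) : Prop :=
  descending z T /\ length T = length S /\ incl T (S ++ map neg S) /\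
  (forall a, In a S -> In a T \/ In (neg a) T).

Lemma decides_insert a g S T k (D : X -> Prop) :
  (length S < 2 ^ k)%nat -> g = a \/ g = neg a ->
  (forall z, D z -> signed_sort S z T /\ 0 <= ev z g) ->
  decides (signed_sort (a :: S)) k D.
Proof.
  intros Hk Hg HD.
  (* The length of [T] is known only through an input satisfying [D]; without one, any answer is
     correct. *)
  destruct (classic (exists z, D z)) as [[z0 Hz0]|Hempty].
  2:{ apply decides_known with []; firstorder. }
  replace k with (k + 0)%nat by lia; apply decides_bind with
    (P := fun z p => T = fst p ++ snd p /\
      (forall b, In b (fst p) -> ev z g <= ev z b) /\
      (forall b, In b (snd p) -> ev z b <= ev z g)).
  - apply decides_position; [|intros z Hz; apply HD, Hz].
    destruct (HD z0 Hz0) as [(_ & -> & _) _]; assumption.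
  - intros [T1 T2]; apply decides_known with (T1 ++ g :: T2); cbn.
    intros z (Hz & -> & H1 & H2); apply HD in Hz as [(Hd & Hlen & Hincl & Hall) Hgz].
    apply descending_app in Hd as (Hd1 & Hd2 & Hd12).
    split; [|split; [|split]].
    + apply descending_app; split; [assumption|]; split; [cbn; auto|].
      intros b c Hb [<-|Hc]; auto.
    + rewrite length_app in *; cbn; lia.
    + assert (Hincl' : incl (T1 ++ T2) ((a :: S) ++ map neg (a :: S))).
      { intros b Hb; apply Hincl, in_app_iff in Hb as [Hb|Hb];
          apply in_app_iff; [left|right]; now right. }
      intros b Hb; apply in_app_iff in Hb as [Hb|[<-|Hb]].
      * apply Hincl', in_app_iff; now left.
      * apply in_app_iff; destruct Hg as [->| ->]; [left|right]; now left.
      * apply Hincl', in_app_iff; now right.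
    + intros b [<-|Hb].
      * destruct Hg as [->| ->]; [left|right]; apply in_app_iff; right; now left.
      * apply Hall in Hb as [Hb|Hb]; apply in_app_iff in Hb as [Hb|Hb];
          [left|left|right|right]; apply in_app_iff; [left|right; right|left|right; right];
          assumption.
Qed.

Lemma decides_signed_sort S k (D : X -> Prop) :
  (length S <= 2 ^ k)%nat -> decides (signed_sort S) (length S * (k + 1)) D.
Proof.
  induction S as [|a S IH]; intros Hk.
  - apply decides_known with []; intros z _; split; [exact I|]; split; [reflexivity|].
    split; [apply incl_nil_l|intros a []].
  - cbn [length] in *.
    (* One test gives the sign of [a], then [k] tests give its position. *)
    replace (Datatypes.S (length S) * (k + 1))%nat
      with (length S * (k + 1) + Datatypes.S k)%nat by lia.
    apply decides_bind with (P := signed_sort S); [apply IH; lia|].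
    intros T; apply decides_test with (fun z => ev z a); [apply query_ev| |].
    + apply decides_insert with (g := a) (T := T); [lia|now left|].
      intros z ((_ & H) & Ha); now split.
    + apply decides_insert with (g := neg a) (T := T); [lia|now right|].
      intros z ((_ & H) & Ha); rewrite ev_neg; split; [assumption|lra].
Qed.

(** * Resolving all signs *)

Section Resolve.

Variables (H : list A) (h d k : nat).
Hypothesis neg_H : forall a, In a H -> In (neg a) H.
Hypothesis length_H : (length H <= 2 ^ h)%nat.
Hypothesis independent_length : forall B, independent B -> (length B <= d)%nat.
(** [2 ^ s] exceeds the number of lists over [H] of length at most [d], the candidates for a basis:
    there are [S d <= 2 ^ d] lengths with at most [2 ^ (h * d)] lists each, and the final successor
    gives strictness. *)
Let s := S (d + h * d).
Hypothesis length_sample : (s <= 2 ^ k)%nat.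

Lemma length_lists_upto :
  (length (flat_map (tuples H) (seq 0 (S d))) < 2 ^ s)%nat.
Proof.
  assert (Hk : forall m, (m <= d)%nat -> (length (tuples H m) <= 2 ^ (h * d))%nat).
  { intros m Hm; rewrite length_tuples, Nat.pow_mul_r.
    transitivity ((2 ^ h) ^ m)%nat; [now apply Nat.pow_le_mono_l|].
    apply Nat.pow_le_mono_r; [apply Nat.pow_nonzero; lia|assumption]. }
  assert (Hd : (S d <= 2 ^ d)%nat) by (apply Nat.pow_gt_lin_r; lia).
  rewrite length_flat_map.
  assert ((list_sum (map (fun x => length (tuples H x)) (seq 0 (S d)))
           <= S d * 2 ^ (h * d))%nat).
  { rewrite <- (length_seq (S d) 0) at 2; rewrite <- list_sum_const.
    apply list_sum_le; intros m Hm; apply in_seq in Hm; apply Hk; lia. }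
  unfold s; cbn [Nat.pow]; rewrite Nat.pow_add_r.
  assert (0 < 2 ^ (h * d))%nat by (apply Nat.neq_0_lt_0, Nat.pow_nonzero; lia).
  nia.
Qed.

(** The sample is fixed beforehand: it meets the unresolved set of every candidate basis that leaves
    more than half of [U] open. The basis [B] of the sorted outcome [T] infers each sampled form or
    its negation, so the sample misses its unresolved set. Hence [B] leaves at most half of [U]
    open, and [T], which infers all that [B] does, leaves no more. *)
Lemma decides_halving U (D : X -> Prop) :
  incl U H ->
  decides (fun z T => descending z T /\
             (2 * length (filter (unresolved T) U) <= length U)%nat)
    (s * (k + 1)) D.
Proof.
  intros HU.
  destruct (hitting_set s (map unresolved (flat_map (tuples H) (seq 0 (S d)))) U)
    as (S & HS & HSs & Hhit).
  { rewrite length_map; apply length_lists_upto. }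
  apply decides_weaken with (1 := decides_signed_sort S k D ltac:(lia));
    [apply Nat.mul_le_mono_r; assumption|auto|].
  intros z T _ (Hdesc & _ & Hincl & Hall); split; [assumption|].
  destruct (exists_basis T) as (B & HBT & HB & HTB & Hinf).
  assert (HTH : incl T H).
  { intros b Hb; apply Hincl, in_app_iff in Hb as [Hb|Hb]; [now apply HU, HS|].
    apply in_map_iff in Hb as (a & <- & Ha); now apply neg_H, HU, HS. }
  transitivity (2 * length (filter (unresolved B) U))%nat.
  - apply Nat.mul_le_mono_l, length_filter_le_filter; intros a.
    unfold unresolved; rewrite !Bool.negb_true_iff, !holds_false.
    unfold infers; intuition.
  - apply Nat.nlt_ge; intros Hbig; destruct (Hhit (unresolved B)) as (a & Ha & Hres).
    + apply in_map, in_flat_map; exists (length B); split.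
      * apply in_seq; specialize (independent_length B HB); lia.
      * apply in_tuples; split; [reflexivity|]; now apply incl_tran with T.
    + exact Hbig.
    + unfold unresolved in Hres; rewrite Bool.negb_true_iff, holds_false in Hres.
      apply Hres; destruct (Hall a Ha); [left|right]; now apply Hinf.
Qed.

Lemma decides_all_signs r U (D : X -> Prop) :
  (length U < 2 ^ r)%nat -> incl U H ->
  decides (fun z (b : A -> bool) => forall a, In a U ->
             if b a then 0 <= ev z a else ev z a <= 0)
    (r * (s * (k + 1))) D.
Proof.
  revert U D; induction r as [|r IH]; intros U D Hr HU.
  - destruct U; [|cbn in Hr; lia].
    apply decides_known with (fun _ => true); intros z _ a [].
  - change (S r * (s * (k + 1)))%nat with (s * (k + 1) + r * (s * (k + 1)))%nat.
    apply (decides_bind _ _ _ _ _ (decides_halving U D HU)); intros T.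
    (* [T] ranges over all lists, also those that no input returns; where halving fails, no input
       remains and any answer is correct. *)
    destruct (le_lt_dec (2 ^ S r) (2 * length (filter (unresolved T) U))) as [Hbig|Hsmall].
    { apply decides_known with (fun _ => true); intros z (_ & _ & Hhalf); lia. }
    rewrite <- (Nat.add_0_r (r * (s * (k + 1)))).
    eapply decides_bind; [apply (IH (filter (unresolved T) U))|].
    + cbn in Hsmall; lia.
    + intros a Ha; apply HU; now apply filter_In in Ha.
    + intros b; apply decides_known with
        (fun a => if holds (infers T a) then true
                  else if holds (infers T (neg a)) then false else b a).
      intros z ((_ & Hdesc & _) & Hb) a Ha.
      destruct (holds (infers T a)) eqn:E1.
      { exact (proj1 (holds_true _) E1 z Hdesc). }
      destruct (holds (infers T (neg a))) eqn:E2.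
      { pose proof (proj1 (holds_true _) E2 z Hdesc) as Hneg; rewrite ev_neg in Hneg; lra. }
      apply Hb, filter_In; split; [assumption|].
      unfold unresolved; apply Bool.negb_true_iff, holds_false.
      apply (proj1 (holds_false _)) in E1, E2; tauto.
Qed.

End Resolve.

End Decides.

(** * From decision procedures to linear decision trees *)

Lemma ldt_of_decides {T} m (out : T -> nat -> (nat -> R) * R)
    (Q : (nat -> R) -> T -> Prop) c D :
  decides _ (fun q => exists a b, forall z, q z = lin_form m a b z) Q c D ->
  exists t, (depth t <= c)%nat /\
    forall z, D z -> exists v, Q z v /\ ldt_leaf m t z = out v.
Proof.
  induction 1 as [c D v Hv|c D q (a & b & Hq) _ (t1 & Ht1 & H1) _ (t2 & Ht2 & H2)].
  - exists (Leaf (out v)); split; [cbn; lia|]; intros z Hz; exists v; auto.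
  (* The two weak tests of [decides] overlap at zero, so the equality branch can reuse the tree for
     nonnegative values. *)
  - exists (Node a b t2 t1 t1); split; [cbn; lia|]; intros z Hz; cbn.
    specialize (Hq z); destruct (total_order_T (lin_form m a b z) 0) as [[Hs|Hs]|Hs].
    + apply H2; split; [assumption|lra].
    + apply H1; split; [assumption|lra].
    + apply H1; split; [assumption|lra].
Qed.

(** * Linear forms with small integer coefficients *)

Lemma lin_form_ext m a a' b z :
  (forall p, (p < m)%nat -> a p = a' p) -> lin_form m a b z = lin_form m a' b z.
Proof.
  intros H; unfold lin_form; do 2 f_equal; apply map_ext_in; intros p Hp.
  apply in_seq in Hp; rewrite H; [reflexivity|lia].
Qed.

Lemma lin_form_comb m s t a b z :
  lin_form m (fun p => s * a p + t * b p) 0 z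
  = s * lin_form m a 0 z + t * lin_form m b 0 z.
Proof.
  unfold lin_form; induction (seq 0 m) as [|p l IH]; cbn; lra.
Qed.

Lemma lin_form_sub m a b z :
  lin_form m (fun p => a p - b p) 0 z = lin_form m a 0 z - lin_form m b 0 z.
Proof.
  rewrite (lin_form_ext _ _ (fun p => 1 * a p + (-1) * b p)) by (intros; lra).
  rewrite lin_form_comb; lra.
Qed.

Lemma lin_form_add m a b z :
  lin_form m (fun p => a p + b p) 0 z = lin_form m a 0 z + lin_form m b 0 z.
Proof.
  rewrite (lin_form_ext _ _ (fun p => 1 * a p + 1 * b p)) by (intros; lra).
  rewrite lin_form_comb; lra.
Qed.

Lemma lin_form_0 m z : lin_form m (fun _ => 0) 0 z = 0.
Proof. unfold lin_form; induction (seq 0 m) as [|p l IH]; cbn; lra. Qed.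

Lemma lin_form_unit m i z :
  (i < m)%nat -> lin_form m (fun p => if Nat.eqb i p then 1 else 0) 0 z = z i.
Proof.
  intros Hi; unfold lin_form.
  assert (Hl : forall l, NoDup l ->
    fold_right Rplus 0 (map (fun p => (if Nat.eqb i p then 1 else 0) * z p) l)
    = if in_dec Nat.eq_dec i l then z i else 0).
  { induction 1 as [|p l Hp Hl IH]; [reflexivity|].
    cbn [map fold_right]; rewrite IH.
    destruct (Nat.eqb_spec i p) as [<-|Hne].
    - destruct (in_dec _ i l); [contradiction|].
      destruct (in_dec _ i (i :: l)) as [_|Hn]; [lra|elim Hn; now left].
    - destruct (in_dec _ i l) as [H1|H1], (in_dec _ i (p :: l)) as [H2|H2];
        cbn in H2; try lra; intuition congruence. }
  rewrite Hl by apply seq_NoDup.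
  destruct in_dec as [_|Hn]; [lra|elim Hn; apply in_seq; lia].
Qed.

Section IntegerForms.

Variables (A : Type) (D w : nat) (coef : A -> nat -> Z).
Hypothesis coef_bound : forall a p, (Z.abs (coef a p) <= Z.of_nat w)%Z.

Definition eval_form (z : nat -> R) (a : A) : R :=
  lin_form D (fun p => IZR (coef a p)) 0 z.

Fixpoint increment_sum_coef (e : list bool) (l : list A) (p : nat) : Z :=
  match e, l with
  | b :: e', a :: l' =>
      ((if b then coef a p - hd 0 (map (fun a => coef a p) l') else 0)
       + increment_sum_coef e' l' p)%Z
  | _, _ => 0%Z
  end.

Lemma increment_sum_coef_bound e l p :
  (Z.abs (increment_sum_coef e l p) <= Z.of_nat (2 * w * length l))%Z.
Proof.
  revert e; induction l as [|a l IH]; intros [|b e]; cbn -[Z.mul Z.of_nat]; try lia.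
  specialize (IH e); pose proof (coef_bound a p).
  assert (Z.abs (hd 0 (map (fun a => coef a p) l)) <= Z.of_nat w)%Z.
  { destruct l as [|c l]; cbn; [lia|apply coef_bound]. }
  destruct b; lia.
Qed.

Lemma increment_sum_lin_form z e l :
  increment_sum _ _ eval_form z e l
  = lin_form D (fun p => IZR (increment_sum_coef e l p)) 0 z.
Proof.
  revert e; induction l as [|a l IH]; intros [|b e]; cbn [increment_sum increment_sum_coef];
    rewrite ?lin_form_0; try reflexivity.
  rewrite (lin_form_ext _ _ (fun p =>
    IZR (if b then coef a p - hd 0 (map (fun a => coef a p) l) else 0)%Z
    + IZR (increment_sum_coef e l p))) by (intros; apply plus_IZR).
  rewrite lin_form_add, IH; f_equal; destruct b; [|now rewrite lin_form_0].
  rewrite (lin_form_ext _ _ (fun p =>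
    IZR (coef a p) - IZR (hd 0 (map (fun a => coef a p) l))%Z))
    by (intros; apply minus_IZR).
  rewrite lin_form_sub; unfold eval_form at 1; f_equal.
  destruct l as [|c l]; cbn; [now rewrite lin_form_0|reflexivity].
Qed.

(* Pigeonhole on the subset sums of increments. *)
Lemma independent_pow_le l :
  independent _ _ eval_form l ->
  (2 ^ length l <= (4 * w * length l + 1) ^ D)%nat.
Proof.
  (* Each increment has coefficients of size at most [2 * w], so subset sums have coefficient
     vectors in [[-M, M]^D], and distinct choices give distinct vectors. *)
  intros Hl; set (M := (2 * w * length l)%nat).
  set (range := map (fun i => (Z.of_nat i - Z.of_nat M)%Z) (seq 0 (2 * M + 1))).
  set (vec := fun e => map (increment_sum_coef e l) (seq 0 D)).
  transitivity (length (map vec (tuples [true; false] (length l)))).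
  { rewrite length_map, length_tuples; reflexivity. }
  replace (4 * w * length l + 1)%nat with (length range)
    by (unfold range, M; rewrite length_map, length_seq; lia).
  rewrite <- length_tuples; apply NoDup_incl_length.
  - apply NoDup_map_NoDup_ForallPairs.
    + intros e e' He He' E; apply in_tuples in He as [He _]; apply in_tuples in He' as [He' _].
      apply (increment_sum_inj _ _ eval_form l); try assumption.
      intros z; rewrite !increment_sum_lin_form; apply lin_form_ext; intros p Hp.
      f_equal; apply (ext_in_map E), in_seq; lia.
    + apply NoDup_tuples; constructor; [intros [|[]]; discriminate|].
      constructor; [intros []|constructor].
  - intros u Hu; apply in_map_iff in Hu as (e & <- & _).
    apply in_tuples; unfold vec; split; [now rewrite length_map, length_seq|].
    intros c Hc; apply in_map_iff in Hc as (p & <- & _).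
    pose proof (increment_sum_coef_bound e l p) as Hb; fold M in Hb.
    apply in_map_iff; exists (Z.to_nat (increment_sum_coef e l p + Z.of_nat M)).
    split; [lia|]; apply in_seq; lia.
Qed.

End IntegerForms.

(** * Sorting from a comparison oracle *)

(** Mirrors [insert_R] on indices: at a leaf the outcomes of comparisons are known, but not the
    values. *)
Fixpoint insert_by (le : nat -> nat -> bool) (i : nat) (l : list nat) : list nat :=
  match l with
  | [] => [i]
  | j :: l' => if le i j then i :: j :: l' else j :: insert_by le i l'
  end.

Fixpoint sort_by (le : nat -> nat -> bool) (l : list nat) : list nat :=
  match l with
  | [] => []
  | i :: l' => insert_by le i (sort_by le l')
  end.

Lemma in_insert_by le i j l : In j (insert_by le i l) <-> j = i \/ In j l.
Proof.
  induction l as [|a l IH]; cbn; [intuition|].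
  destruct (le i a); cbn; [|rewrite IH]; intuition.
Qed.

Lemma in_sort_by le j l : In j (sort_by le l) <-> In j l.
Proof.
  induction l as [|a l IH]; cbn; [reflexivity|].
  rewrite in_insert_by, IH; intuition.
Qed.

Lemma in_insert_R x y l : In y (insert_R x l) <-> y = x \/ In y l.
Proof.
  induction l as [|a l IH]; cbn; [intuition|].
  destruct Rle_dec; cbn; [|rewrite IH]; intuition.
Qed.

Lemma insert_R_sorted x l : StronglySorted Rle l -> StronglySorted Rle (insert_R x l).
Proof.
  induction 1 as [|y l Hl IH Hy]; cbn; [repeat constructor|].
  destruct Rle_dec as [Hxy|Hxy].
  - constructor; [now constructor|]; constructor; [assumption|].
    apply Forall_forall; intros a Ha; rewrite Forall_forall in Hy.
    specialize (Hy a Ha); lra.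
  - constructor; [assumption|]; apply Forall_forall; intros a Ha.
    apply in_insert_R in Ha as [->|Ha]; [lra|]; rewrite Forall_forall in Hy; auto.
Qed.

Lemma sort_R_sorted l : StronglySorted Rle (sort_R l).
Proof. induction l; cbn; [constructor|now apply insert_R_sorted]. Qed.

Lemma length_insert_R x l : length (insert_R x l) = S (length l).
Proof. induction l; cbn; [reflexivity|]; destruct Rle_dec; cbn; lia. Qed.

Lemma length_sort_R l : length (sort_R l) = length l.
Proof. induction l; cbn; [reflexivity|]; rewrite length_insert_R; lia. Qed.

Lemma insert_R_head x l : Forall (Rle x) l -> insert_R x l = x :: l.
Proof. destruct 1; cbn; [reflexivity|]; destruct Rle_dec; [reflexivity|contradiction]. Qed.

(* With ties the oracle need not be transitive, nor agree with [Rle_dec]; the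
   sorted lists of values still coincide. *)
Lemma map_insert_by (le : nat -> nat -> bool) (f : nat -> R) i l :
  (forall j, In j l -> if le i j then f i <= f j else f j <= f i) ->
  StronglySorted Rle (map f l) ->
  map f (insert_by le i l) = insert_R (f i) (map f l).
Proof.
  induction l as [|j l IH]; intros Hle Hs; [reflexivity|].
  cbn in Hs; inversion_clear Hs as [|? ? Hs' Hj].
  pose proof (Hle j (or_introl eq_refl)) as Hij; cbn [insert_by].
  destruct (le i j).
  - cbn; destruct Rle_dec; [reflexivity|contradiction].
  - cbn; rewrite IH; [|intros; apply Hle; now right|assumption].
    destruct Rle_dec as [H|H]; [|reflexivity].
    assert (E : f i = f j) by lra.
    rewrite E, insert_R_head; [reflexivity|assumption].
Qed.

Lemma map_sort_by (le : nat -> nat -> bool) (f : nat -> R) l :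
  (forall i j, In i l -> In j l -> if le i j then f i <= f j else f j <= f i) ->
  map f (sort_by le l) = sort_R (map f l).
Proof.
  induction l as [|i l IH]; intros Hle; [reflexivity|]; cbn.
  rewrite <- IH by (intros; apply Hle; now right).
  apply map_insert_by.
  - intros j Hj; apply in_sort_by in Hj; apply Hle; [now left|now right].
  - rewrite IH by (intros; apply Hle; now right); apply sort_R_sorted.
Qed.

(** The index of the median depends on [le] alone, so a leaf can name it as a fixed output. *)
Lemma median_sort_by (le : nat -> nat -> bool) (f : nat -> R) l :
  l <> [] ->
  (forall i j, In i l -> In j l -> if le i j then f i <= f j else f j <= f i) ->
  let i := nth (pred (length l) / 2) (sort_by le l) 0%nat in
  In i l /\ median (map f l) = f i.
Proof.
  intros Hl Hle i; pose proof (map_sort_by le f l Hle) as E.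
  assert (Hlen : length (sort_by le l) = length l).
  { rewrite <- (length_map f), E, length_sort_R; apply length_map. }
  assert (Hlt : (pred (length l) / 2 < length l)%nat).
  { destruct l as [|j l]; [congruence|]; cbn [length pred].
    pose proof (Nat.Div0.div_le_upper_bound (length l) 2 (length l)); lia. }
  split.
  - apply (in_sort_by le), nth_In; lia.
  - unfold median; rewrite <- E, length_map.
    (* [map_nth] needs a default in the image of [f]; the rank is in range, so the default may be
       changed. *)
    rewrite (nth_indep _ 0 (f 0%nat)) by (rewrite length_map; lia).
    apply map_nth.
Qed.

(** * Comparisons of diagonal entries *)

(* [entry_coef n k i] is [x_i - y_{k-i}]; the triple [(k, i, j)] stands for
   [(x_j - y_{k-j}) - (x_i - y_{k-i})]. *)
Definition entry_coef (n k i p : nat) : Z :=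
  ((if Nat.eqb i p then 1 else 0) - (if Nat.eqb (n + (k - i)) p then 1 else 0))%Z.

Definition comparison_coef (n : nat) (a : nat * nat * nat) (p : nat) : Z :=
  let '(k, i, j) := a in (entry_coef n k j p - entry_coef n k i p)%Z.

Definition swap (a : nat * nat * nat) : nat * nat * nat :=
  let '(k, i, j) := a in (k, j, i).

(** The full cube is closed under [swap]. For [i > k] the truncated [k - i] is zero and the form
    reads [y_0], which is still a form of the same shape. *)
Definition comparisons (n : nat) : list (nat * nat * nat) :=
  list_prod (list_prod (seq 0 n) (seq 0 n)) (seq 0 n).

Lemma in_comparisons n k i j :
  In (k, i, j) (comparisons n) <-> (k < n /\ i < n /\ j < n)%nat.
Proof. unfold comparisons; rewrite !in_prod_iff, !in_seq; lia. Qed.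

Lemma length_comparisons n : length (comparisons n) = (n * n * n)%nat.
Proof. unfold comparisons; rewrite !length_prod, length_seq; reflexivity. Qed.

Lemma comparison_coef_bound n a p :
  (Z.abs (comparison_coef n a p) <= Z.of_nat 2)%Z.
Proof.
  destruct a as [[k i] j]; unfold comparison_coef, entry_coef.
  destruct (Nat.eqb j p), (Nat.eqb (n + (k - j)) p), (Nat.eqb i p), (Nat.eqb (n + (k - i)) p);
    cbn; lia.
Qed.

Lemma lin_form_entry n k i z :
  (k < n)%nat -> (i < n)%nat ->
  lin_form (2 * n) (fun p => IZR (entry_coef n k i p)) 0 z = z i - z (n + (k - i))%nat.
Proof.
  intros Hk Hi.
  rewrite (lin_form_ext _ _ (fun p => (if Nat.eqb i p then 1 else 0)
             - (if Nat.eqb (n + (k - i)) p then 1 else 0))).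
  - rewrite lin_form_sub, !lin_form_unit by lia; reflexivity.
  - intros p _; unfold entry_coef; rewrite minus_IZR.
    destruct (Nat.eqb i p), (Nat.eqb (n + (k - i)) p); reflexivity.
Qed.

Lemma eval_comparison n k i j z :
  (k < n)%nat -> (i < n)%nat -> (j < n)%nat ->
  eval_form _ (2 * n) (comparison_coef n) z (k, i, j)
  = (z j - z (n + (k - j))%nat) - (z i - z (n + (k - i))%nat).
Proof.
  intros Hk Hi Hj; rewrite <- !lin_form_entry, <- lin_form_sub by assumption.
  apply lin_form_ext; intros p _; apply minus_IZR.
Qed.

Lemma eval_swap n z a :
  eval_form _ (2 * n) (comparison_coef n) z (swap a)
  = - eval_form _ (2 * n) (comparison_coef n) z a.
Proof.
  destruct a as [[k i] j]; unfold eval_form, swap, comparison_coef.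
  rewrite (lin_form_ext _ _ (fun p => 0 - IZR (entry_coef n k j p - entry_coef n k i p))).
  - rewrite lin_form_sub, lin_form_0; lra.
  - intros p _; rewrite !minus_IZR; lra.
Qed.

Lemma independent_skipn X A (ev : X -> A -> R) m l :
  independent X A ev l -> independent X A ev (skipn m l).
Proof.
  revert l; induction m as [|m IH]; intros [|a l] H; cbn; try assumption.
  apply IH, H.
Qed.

Lemma independent_comparisons_length n L B :
  (n < 2 ^ L)%nat -> (2 <= L)%nat -> (1 <= n)%nat ->
  independent _ _ (eval_form _ (2 * n) (comparison_coef n)) B ->
  (length B <= 16 * n * L)%nat.
Proof.
  intros Hn HL Hn1 HB; apply Nat.nlt_ge; intros Hlt.
  set (m := (16 * n * L)%nat) in *.
  (* Independence passes to tails, so it is enough to refute a list of length exactly [m]: the last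
     [m] elements of [B]. *)
  apply (independent_skipn _ _ _ (length B - m)) in HB.
  apply (independent_pow_le _ _ 2 _ (comparison_coef_bound n)) in HB.
  rewrite length_skipn in HB; replace (length B - (length B - m))%nat with m in HB by lia.
  assert (HL2 : (L < 2 ^ L)%nat) by (apply Nat.pow_gt_lin_r; lia).
  assert (Hbase : (4 * 2 * m + 1 <= 2 ^ (7 + 2 * L))%nat).
  { rewrite Nat.pow_add_r; replace (2 * L)%nat with (L + L)%nat by lia.
    rewrite Nat.pow_add_r; change (2 ^ 7)%nat with 128%nat; unfold m.
    assert (n * L + 1 <= 2 ^ L * 2 ^ L)%nat by nia. nia. }
  assert (Hle : (2 ^ m <= 2 ^ ((7 + 2 * L) * (2 * n)))%nat).
  { rewrite Nat.pow_mul_r; etransitivity; [exact HB|]; now apply Nat.pow_le_mono_l. }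
  (* The exponents would give [16 n L <= 14 n + 4 n L], but [14 n <= 7 n L] as [L >= 2]. *)
  apply Nat.pow_le_mono_r_iff in Hle; [|lia]; unfold m in Hle; nia.
Qed.

Lemma exists_median_conv_ldt n L :
  (n < 2 ^ L)%nat -> (2 <= L)%nat -> (1 <= n)%nat ->
  exists t, computes_median_conv n t /\ (depth t <= 2145 * n * L ^ 4)%nat.
Proof.
  intros Hn HL Hn1.
  set (ev := eval_form _ (2 * n) (comparison_coef n)).
  assert (Hlen : (length (comparisons n) < 2 ^ (3 * L))%nat).
  { rewrite length_comparisons; replace (3 * L)%nat with (L + L + L)%nat by lia.
    rewrite !Nat.pow_add_r.
    assert (n * n < 2 ^ L * 2 ^ L)%nat by nia; nia. }
  assert (HL2 : (L < 2 ^ L)%nat) by (apply Nat.pow_gt_lin_r; lia).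
  (* If [b (k, i, j)] is true, entry [i] of diagonal [k] is at most entry [j], otherwise at least;
     so [b] is a comparison oracle on each diagonal. *)
  pose (out := fun (b : nat * nat * nat -> bool) k =>
    let i := nth (pred (length (seq 0 (S k))) / 2)
               (sort_by (fun i j => b (k, i, j)) (seq 0 (S k))) 0%nat in
    (fun p => IZR (entry_coef n k i p), 0)).
  (* Parameters: [h = r = 3 L], as there are [n ^ 3 < 2 ^ (3 L)] comparisons; [d = 16 n L]; and
     [k = 3 L + 7], as the sample size is at most [65 n L ^ 2 <= 2 ^ 7 * 2 ^ (3 L)]. *)
  assert (Hsample : (S (16 * n * L + 3 * L * (16 * n * L)) <= 65 * n * L * L)%nat) by nia.
  destruct (ldt_of_decides (2 * n) out
    (fun z b => forall a, In a (comparisons n) -> if b a then 0 <= ev z a else ev z a <= 0)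
    (3 * L * (S (16 * n * L + 3 * L * (16 * n * L)) * (3 * L + 7 + 1))) (fun _ => True))
    as (t & Ht & Hleaf).
  { apply (decides_all_signs _ _ _ ev swap) with (H := comparisons n).
    - intros z a; apply eval_swap.
    - intros a; eexists; exists 0; intros z; reflexivity.
    - intros a b; eexists; exists 0; intros z; unfold ev, eval_form.
      rewrite <- lin_form_sub; reflexivity.
    - intros [[k i] j]; cbn [swap]; rewrite !in_comparisons; lia.
    - lia.
    - intros B; now apply independent_comparisons_length.
    - etransitivity; [exact Hsample|].
      replace (3 * L + 7)%nat with (7 + L + L + L)%nat by lia.
      rewrite !Nat.pow_add_r; change (2 ^ 7)%nat with 128%nat.
      assert (n * L <= 2 ^ L * 2 ^ L)%nat by nia; nia.
    - exact Hlen.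
    - apply incl_refl. }
  exists t; split.
  - intros z k Hk; destruct (Hleaf z I) as (b & Hb & E).
    unfold ldt_output; rewrite E; cbn [out fst snd].
    destruct (median_sort_by (fun i j => b (k, i, j))
                (fun i => z i - z (n + (k - i))%nat) (seq 0 (S k))) as [Hi Hmed].
    + discriminate.
    + intros i j Hi Hj; apply in_seq in Hi, Hj.
      specialize (Hb (k, i, j)); rewrite in_comparisons in Hb; unfold ev in Hb.
      rewrite eval_comparison in Hb by lia.
      destruct (b (k, i, j)); specialize (Hb ltac:(lia)); lra.
    + unfold median_conv; rewrite Hmed; apply in_seq in Hi; apply lin_form_entry; lia.
  - etransitivity; [exact Ht|].
    (* Here [3 L + 8 <= 11 L], and [2145 = 3 * 65 * 11]. *)
    transitivity (3 * L * (65 * n * L * L * (11 * L)))%nat.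
    + apply Nat.mul_le_mono_l, Nat.mul_le_mono; [exact Hsample|lia].
    + cbn [Nat.pow]; lia.
Qed.

(** * The depth bound *)

(** By eighth powers from [L <= 16 * 2 ^ (L / 8)], which follows from [q < 2 ^ q] at [q = L / 8].
    The exponent is eight because [L ^ 4] is compared with a square root. *)
Lemma pow8_le_pow2 L : (L ^ 8 <= 16 ^ 8 * 2 ^ L)%nat.
Proof.
  pose proof (Nat.div_mod_eq L 8); pose proof (Nat.mod_upper_bound L 8 ltac:(lia)).
  assert (L / 8 < 2 ^ (L / 8))%nat by (apply Nat.pow_gt_lin_r; lia).
  transitivity ((16 * 2 ^ (L / 8)) ^ 8)%nat; [apply Nat.pow_le_mono_l; lia|].
  rewrite Nat.pow_mul_l, <- Nat.pow_mul_r.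
  apply Nat.mul_le_mono_l, Nat.pow_le_mono_r; lia.
Qed.

Lemma lg_ge_1 x : 2 <= x -> 1 <= lg x.
Proof.
  intros Hx; unfold lg.
  assert (0 < ln 2) by (rewrite <- ln_1; apply ln_increasing; lra).
  assert (ln 2 <= ln x) by (destruct Hx as [Hx|<-]; [left; apply ln_increasing|]; lra).
  apply Rmult_le_reg_r with (ln 2); [assumption|].
  unfold Rdiv; rewrite Rmult_assoc, Rinv_l; lra.
Qed.

(** After squaring, with [L = S (Nat.log2 n)]: [L ^ 8 <= 16 ^ 8 * 2 ^ L], where [2 ^ L <= 2 n], and
    [lg n >= 1]. *)
Lemma polylog_le_sqrt n :
  (2 <= n)%nat ->
  INR (S (Nat.log2 n) ^ 4) <= 2 * 16 ^ 4 * sqrt (INR n * lg (INR n)).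
Proof.
  intros Hn; set (L := S (Nat.log2 n)).
  assert (HL : (2 ^ L <= 2 * n)%nat).
  { unfold L; cbn [Nat.pow]; apply Nat.mul_le_mono_l, Nat.log2_spec; lia. }
  assert (H8 : INR (L ^ 4) * INR (L ^ 4) <= 16 ^ 8 * (2 * INR n)).
  { rewrite <- mult_INR, <- Nat.pow_add_r; change (4 + 4)%nat with 8%nat.
    replace (16 ^ 8) with (INR 16 ^ 8) by (rewrite INR_IZR_INZ; reflexivity).
    rewrite <- pow_INR; change 2 with (INR 2); rewrite <- !mult_INR; apply le_INR.
    etransitivity; [apply pow8_le_pow2|]; now apply Nat.mul_le_mono_l. }
  assert (Hn2 : 2 <= INR n) by (change 2 with (INR 2); now apply le_INR).
  pose proof (lg_ge_1 _ Hn2).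
  assert (0 <= INR (L ^ 4)) by apply pos_INR.
  apply Rsqr_incr_0_var.
  - unfold Rsqr at 1; rewrite Rsqr_mult, Rsqr_sqrt by nra.
    apply Rle_trans with (1 := H8); unfold Rsqr; nra.
  - apply Rmult_le_pos; [lra|apply sqrt_pos].
Qed.

Theorem theorem12 :
  exists C : R, 0 < C /\
  exists N0 : nat, forall n : nat, (N0 <= n)%nat ->
    exists t : ldt, computes_median_conv n t /\
      INR (depth t) <= C * INR n * sqrt (INR n * lg (INR n)).
Proof.
  (* From [n >= 2] come both [S (Nat.log2 n) >= 2] and [lg n >= 1]; the constant is the product of
     those in the two bounds. *)
  exists (2145 * (2 * 16 ^ 4)); split; [lra|]; exists 2%nat; intros n Hn.
  destruct (exists_median_conv_ldt n (S (Nat.log2 n))) as (t & Ht & Hdepth).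
  - apply Nat.log2_spec; lia.
  - apply le_n_S, Nat.log2_pos; lia.
  - lia.
  - exists t; split; [assumption|].
    apply le_INR in Hdepth; rewrite !mult_INR in Hdepth.
    apply Rle_trans with (1 := Hdepth).
    replace (INR 2145) with 2145 by (rewrite INR_IZR_INZ; reflexivity).
    pose proof (polylog_le_sqrt n Hn); pose proof (pos_INR n); nra.
Qed.
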